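(* Let $n,d$ be positive integers with $1\le d<\frac{n-1}{2}$. The circuit distance power $C_n^{(d)}$ has eigenvalue $1$ if and only if $6\mid n$ and $d\equiv 1 \pmod 6$. In this case, the multiplicity of the eigenvalue $1$ equals two.
   Context: $C_n$ denotes the circuit (cycle) graph on $n$ vertices. For a graph $G$ and a positive integer $d$, the $d$-th distance power $G^{(d)}$ is the graph obtained from $G$ by adding edges between all pairs of distinct vertices whose distance in $G$ is at most $d$. The eigenvalues of a graph, and their multiplicities, are those of its adjacency matrix. The condition $1\le d<\frac{n-1}{2}$ expresses that $C_n^{(d)}$ is non-complete. *)

(* Defs.v *)
From mathcomp Require Import all_boot all_order all_algebra.

Set Implicit Arguments.
Unset Strict Implicit.
Unset Printing Implicit Defensive.

Import GRing.Theory.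

Local Open Scope ring_scope.

(* Simple graphs are given by their adjacency relation [e : rel T]. *)
Definition walk (T : finType) (e : rel T) (k : nat) (x y : T) : bool :=
  [exists p : k.-tuple T, path e x p && (last x p == y)].

(* A shortest walk has fewer than #|T| edges, so this is the usual distance
   when x and y are connected; otherwise it is the junk value #|T|, which is
   why [dist_power] also tests connectedness. *)
Definition gdist (T : finType) (e : rel T) (x y : T) : nat :=
  find (fun k => walk e k x y) (iota 0 #|T|).

Definition dist_power (T : finType) (e : rel T) (d : nat) : rel T :=
  [rel x y | e x y || [&& x != y, connect e x y & (gdist e x y <= d)%N]].

(* [ordS] is the successor modulo n, so for n >= 3 this is the circuit C_n
   (for n = 1 it would be a loop, for n = 2 a single edge). *)
Definition circuit (n : nat) : rel 'I_n :=
  [rel i j | (j == ordS i) || (i == ordS j)].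

Definition adjmx (R : nzRingType) (n : nat) (e : rel 'I_n) : 'M[R]_n :=
  \matrix_(i, j) (e i j)%:R.

(* Algebraic multiplicity; for the symmetric matrices considered here it is
   also the dimension of the eigenspace. *)
Definition eigen_mult (F : fieldType) (n : nat) (A : 'M[F]_n) (a : F) : nat :=
  mup a (char_poly A).

(* Main.v *)
Require Import Defs.
From mathcomp Require Import all_boot all_order all_algebra all_field.
From mathcomp Require Import zify ring.

Set Implicit Arguments.
Unset Strict Implicit.
Unset Printing Implicit Defensive.

Import Order.TTheory GRing.Theory Num.Theory.

Local Open Scope ring_scope.

(** Index the vertices by the integers modulo n. Since 2d+1 < n, two vertices
    are adjacent in the d-th power of the circuit exactly when they differ by
    one of the 2d distinct residues 1, -1, ..., d, -d. The adjacency matrix is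
    thus circulant, and the discrete Fourier basis diagonalises it: its
    eigenvalues, with multiplicities, are the sums over t in {1,-1,...,d,-d}
    of x^t, where x runs over the n-th roots of unity
    ([char_poly_circulant], [dist_power_circuitE]).

    For x = 1 the sum is 2d, which is even, hence not 1. For x <> 1, clearing
    the geometric sums turns the condition that the eigenvalue be 1 into
    x^(2d+1) - 1 = 2 x^d (x - 1). The root of unity w = x^(2d+1) is then
    congruent to 1 modulo 2 in the ring of algebraic integers. This forces
    w^2 = 1 ([unity_root_eq1_mod2]): if w has order m, the product of the
    1 - w^k for 0 < k < m equals m and is divisible by 2^(m-1), so m <= 2. The
    value w = 1 would give x = 1; so w = -1 and x^d (x - 1) = -1. Hence x and
    x - 1 both lie on the unit circle, which makes x a primitive 6th root of
    unity, and comparing arguments gives d = 1 mod 6; the converse is a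
    computation ([eigenvalue1_equation]). A primitive 6th root of unity is an
    n-th root of unity exactly when 6 divides n, and there are two of them
    ([card_prim6_powers]), whence the multiplicity.

    All of this takes place over the algebraic numbers, where roots of unity
    and algebraic integers live. The adjacency matrix has rational entries and
    the multiplicity of a rational root does not change under field extension
    ([eigen_mult_map]), so the result passes to any real closed field. *)

(** * Roots of unity congruent to 1 modulo 2 *)

(** This is X^m - 1 = prod (X - w^k), divided by X - 1 and evaluated at 1. *)
Lemma prod_1sub_prim_root (F : fieldType) (m : nat) (w : F) :
  m.-primitive_root w -> \prod_(1 <= k < m) (1 - w ^+ k) = m%:R.
Proof.
move=> w_m; have m_gt0 := prim_order_gt0 w_m.
have := factor_Xn_sub_1 w_m; rewrite big_ltn // expr0 subrX1.
move/(mulfI (negbT (polyXsubC_eq0 1))) => /(congr1 (horner^~ 1)).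
rewrite horner_prod horner_sum => eq1.
transitivity (\prod_(1 <= k < m) ('X - (w ^+ k)%:P).[1]).
  by apply: eq_bigr => k _; rewrite hornerXsubC.
rewrite eq1 (eq_bigr (fun=> 1)) => [|i _]; last by rewrite hornerXn expr1n.
by rewrite sumr_const card_ord.
Qed.

(** Each 1 - w^i is a multiple of 1 - w, hence of 2; if w has order k, the
    product formula above makes 2^(k-1) divide k among algebraic integers, so
    among integers, which leaves only k <= 2. *)
Lemma unity_root_eq1_mod2 (w : algC) (m : nat) :
  (0 < m)%N -> w ^+ m = 1 -> (w - 1) / 2 \in Aint -> w ^+ 2 = 1.
Proof.
move=> m_gt0 wm1 w_eq1.
have [k w_k _] := prim_order_exists m_gt0 wm1.
have k_gt0 := prim_order_gt0 w_k.
have Aw := Aint_prim_root w_k.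
have Aquot : k%:R / 2 ^+ k.-1 \in Aint.
  rewrite -(prod_1sub_prim_root w_k) -subn1 -prodr_const_nat -prodf_div.
  apply: rpred_prod => i _.
  rewrite -opprB subrX1 mulNr mulrAC rpredN rpredM //.
  by apply: rpred_sum => j _; apply: rpredX.
have Cquot : (k%:R / 2 ^+ k.-1 : algC) \is a Num.int.
  by apply: Cint_rat_Aint => //; rewrite rpred_div ?rpredX ?rpred_nat.
have le2k : (2 ^ k.-1 <= k)%N.
  have := norm_intr_ge1 Cquot.
  rewrite mulf_neq0 ?invr_eq0 ?expf_neq0 ?pnatr_eq0 -?lt0n // => /(_ isT).
  rewrite ger0_norm ?divr_ge0 ?exprn_ge0 ?ler0n //.
  by rewrite ler_pdivlMr ?exprn_gt0 ?ltr0n // mul1r -natrX ler_nat.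
have k_le2 : (k <= 2)%N.
  case: k {w_k k_gt0 Aquot Cquot} le2k => [|[|[|k]]] //=.
  elim: k => // k IHk; rewrite expnS; lia.
apply/eqP; rewrite -(prim_order_dvd w_k).
by case: k k_gt0 k_le2 {w_k Aquot Cquot le2k} => [|[|[|]]].
Qed.

(** * Primitive sixth roots of unity *)

(** X^2 - X + 1 is the sixth cyclotomic polynomial. *)
Lemma prim6_rootE (F : numFieldType) (x : F) :
  6.-primitive_root x = (x ^+ 2 - x + 1 == 0).
Proof.
apply/idP/eqP => [x_6 | x_root].
  have x6 := prim_expr_order x_6.
  have x3 : x ^+ 3 - 1 != 0 by rewrite subr_eq0 -(prim_order_dvd x_6).
  have x2 : x + 1 != 0.
    apply: contraTneq (isT : ~~ (6 %| 2)%N) => x1.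
    rewrite negbK (prim_order_dvd x_6).
    have -> : x = -1 by apply/eqP; rewrite -addr_eq0 x1.
    by rewrite sqrrN expr1n.
  apply: (mulfI x2); apply: (mulfI x3); rewrite !mulr0.
  by transitivity (x ^+ 6 - 1); [ring | rewrite x6 subrr].
have x2 : x ^+ 2 = x - 1 by rewrite -[LHS]subr0 -x_root; ring.
have x3 : x ^+ 3 = -1 by rewrite exprS x2 mulrBr -expr2 x2; ring.
have [|m x_m] := @prim_order_exists _ 6 x isT.
  by rewrite (exprM x 3 2) x3 sqrrN expr1n.
have N3 : x ^+ 3 != 1.
  by rewrite x3 -subr_eq0 -opprD oppr_eq0 (_ : 1 + 1 = 2%:R) // pnatr_eq0.
have N2 : x ^+ 2 != 1.
  apply: contraNneq N3 => x2'; rewrite x2' in x2.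
  have x_2 : x = 2 by rewrite -[LHS](subrK 1) -x2; ring.
  have three0 : 3%:R = 0 :> F.
    by transitivity (x ^+ 2 - 1); [rewrite x_2; ring | rewrite x2' subrr].
  by move/eqP: three0; rewrite pnatr_eq0.
move=> m6; have /or4P : [|| m == 1, m == 2, m == 3 | m == 6]%N.
  have := @dvdn_leq m 6 isT m6.
  by case: m m6 {x_m} => [|[|[|[|[|[|[|m]]]]]]] //=.
case=> /eqP Dm; rewrite Dm in x_m => //.
- by case/eqP: N2; rewrite -(expr1 x) (prim_expr_order x_m) expr1n.
- by case/eqP: N2; rewrite (prim_expr_order x_m).
- by case/eqP: N3; rewrite (prim_expr_order x_m).
Qed.

Lemma prim6_rootX3 (F : numFieldType) (x : F) :
  6.-primitive_root x -> x ^+ 3 = -1.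
Proof.
rewrite prim6_rootE => /eqP x_root.
by rewrite -[RHS]addr0 -[0](mulr0 (x + 1)) -x_root; ring.
Qed.

(** The heart of the matter: w = x^(2d+1) is congruent to 1 modulo 2, hence is 1
    or -1; the first forces x = 1, the second forces x and x - 1 to have norm
    1, which characterises the two primitive sixth roots of unity. *)
Lemma eigenvalue1_equation (x : algC) (n d : nat) :
    (0 < n)%N -> x ^+ n = 1 -> x != 1 ->
  (x ^+ (2 * d).+1 - 1 == 2 * (x ^+ d * (x - 1)))
    = 6.-primitive_root x && (d == 1 %[mod 6])%N.
Proof.
move=> n_gt0 xn1 x_neq1.
have xB1_neq0 : x - 1 != 0 by rewrite subr_eq0.
have Ax : x \in Aint by apply: (@Aint_unity_root n) => //; apply/unity_rootP.
apply/eqP/andP => [eqx | [x_6 /eqP d1]]; last first.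
  have xd : x ^+ d = x by rewrite -(prim_expr_mod x_6) d1 (prim_expr_mod x_6).
  have x3 := prim6_rootX3 x_6.
  move: x_6; rewrite prim6_rootE => /eqP x_root.
  rewrite exprSr mulnC exprM xd -exprSr x3.
  by rewrite -[LHS]addr0 -[0](mulr0 2) -x_root; ring.
have x_neq0 : x != 0.
  by apply: contra_eq_neq xn1 => ->; rewrite expr0n gtn_eqF // eq_sym oner_neq0.
pose w := x ^+ (2 * d).+1.
have w2 : w ^+ 2 = 1.
  apply: (@unity_root_eq1_mod2 w n) => //; first by rewrite exprAC xn1 expr1n.
  by rewrite eqx mulrC mulKf ?pnatr_eq0 // rpredM ?rpredX // rpredB.
have w_neq1 : w != 1.
  rewrite -subr_eq0 eqx mulf_neq0 ?pnatr_eq0 // mulf_neq0 //.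
  by rewrite expf_neq0.
have {w2 w_neq1} wN1 : w = -1.
  by move/eqP: w2; rewrite sqrf_eq1 (negPf w_neq1) => /eqP.
have {eqx} eqx : x ^+ d * (x - 1) = -1.
  apply: (@mulfI _ 2); rewrite ?pnatr_eq0 // -eqx -/w wN1; ring.
have norm_x : `|x| = 1.
  by apply/eqP; rewrite -(@pexpr_eq1 _ _ n) // -normrX xn1 normr1.
have norm_xB1 : `|x - 1| = 1.
  have /(congr1 Num.norm) := eqx.
  by rewrite normrM normrX norm_x expr1n mul1r normrN1.
have x_6 : 6.-primitive_root x.
  rewrite prim6_rootE; apply/eqP.
  have := normCK x; rewrite norm_x expr1n => xxC.
  have := normCK (x - 1); rewrite norm_xB1 expr1n rmorphB rmorph1 => xBC.
  (* xxC and xBC say 1 = x x^* and 1 = (x - 1) (x - 1)^*; subtracting these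
     yields x + x^* = 1. *)
  have yE : x^* = 1 - x.
    transitivity (1 + x * x^* - (x - 1) * (x^* - 1) - x); first by ring.
    by rewrite -xxC -xBC; ring.
  by rewrite [X in _ + X]xxC yE; ring.
split=> //; rewrite -(eqn_modDr 2) -(eq_prim_root_expr x_6) addn2.
have xB1 : x - 1 = x ^+ 2.
  move: x_6; rewrite prim6_rootE => /eqP x_root.
  by rewrite -[RHS]subr0 -x_root; ring.
by rewrite -addn2 exprD -xB1 eqx (prim6_rootX3 x_6).
Qed.

(** * Circulant matrices *)

(** The Fourier vectors, columns of a Vandermonde matrix on the distinct points
    w^k, form a basis of eigenvectors. *)
Lemma char_poly_circulant (F : fieldType) (n : nat) (w : F) (f : nat -> F) :
    n.+1.-primitive_root w ->
  char_poly (\matrix_(i, j < n.+1) f (j - i : 'I_n.+1))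
    = \prod_(k < n.+1) ('X - (\sum_(t < n.+1) f t * (w ^+ k) ^+ t)%:P).
Proof.
move=> w_n; set A := \matrix_(i, j) _.
pose eig (k : 'I_n.+1) := \sum_(t < n.+1) f t * (w ^+ k) ^+ t.
pose V := Vandermonde n.+1 (\row_(k < n.+1) w ^+ k).
pose D := diag_mx (\row_k eig k).
have AV : A *m V = V *m D.
  apply/matrixP => i k; rewrite mul_mx_diag !mxE.
  (* The exponent of x = w^k only matters modulo n+1, so the sum over j can be
     shifted to one over t = j - i, whatever wraps around. *)
  have wkn : (w ^+ k) ^+ n.+1 = 1.
    by rewrite exprAC (prim_expr_order w_n) expr1n.
  rewrite (reindex (+%R i)) /=; last first.
    exists (fun t => t - i) => t _; rewrite addrC ?subrK //.
    by rewrite addrA addNr add0r.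
  rewrite big_distrr /=; apply: eq_bigr => t _.
  by rewrite !mxE [i + t]addrC addrK addrC /= expr_mod // exprD; ring.
have V_neq0 : \det V != 0.
  rewrite det_Vandermonde; apply/prodf_neq0 => i _; apply/prodf_neq0 => j ltij.
  rewrite !mxE subr_eq0 (eq_prim_root_expr w_n) !modn_small ?ltn_ord //.
  by rewrite gtn_eqF.
pose toP := map_mx (@polyC F).
have comm : char_poly_mx A *m toP _ _ V = toP _ _ V *m char_poly_mx D.
  rewrite mulmxBl mulmxBr -!map_mxM AV; congr (_ - _).
  by rewrite scalar_mxC.
have -> : \prod_(k < n.+1) ('X - (eig k)%:P) = char_poly D.
  rewrite char_poly_trig ?diag_mx_is_trig //.
  by apply: eq_bigr => k _; rewrite !mxE eqxx.
have detP : \det (toP _ _ V) != 0 by rewrite det_map_mx polyC_eq0.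
by apply: (mulIf detP); rewrite -det_mulmx comm det_mulmx mulrC.
Qed.

(** * Multiplicities under field extension *)

Lemma mup_map_poly (F L : fieldType) (f : {rmorphism F -> L}) (a : F) p :
  p != 0 -> mup (f a) (map_poly f p) = mup a p.
Proof.
move=> p_neq0; have fp_neq0 : map_poly f p != 0 by rewrite map_poly_eq0.
have same k : (k <= mup (f a) (map_poly f p))%N = (k <= mup a p)%N.
  rewrite !mup_geq // -(dvdp_map f) rmorphXn /= rmorphB /= map_polyX.
  by rewrite map_polyC.
by apply/eqP; rewrite eqn_leq -same leqnn same leqnn.
Qed.

Lemma eigen_mult_map (F L : fieldType) (f : {rmorphism F -> L}) (n : nat)
    (A : 'M[F]_n) (a : F) :
  eigen_mult (map_mx f A) (f a) = eigen_mult A a.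
Proof.
rewrite /eigen_mult -map_char_poly mup_map_poly // monic_neq0 //.
exact: char_poly_monic.
Qed.

Lemma eigenvalue_mult_gt0 (F : fieldType) (n : nat) (A : 'M[F]_n) (a : F) :
  eigenvalue A a = (0 < eigen_mult A a)%N.
Proof.
rewrite eigenvalue_root_char root_factor_theorem [RHS]mup_geq //.
by rewrite monic_neq0 // char_poly_monic.
Qed.

Lemma map_adjmx (R S : nzRingType) (f : {rmorphism R -> S}) (n : nat)
    (e : rel 'I_n) :
  map_mx f (adjmx R e) = adjmx S e.
Proof. by apply/matrixP => i j; rewrite !mxE rmorph_nat. Qed.

(** * Distance powers of circuits *)

(** The residues t modulo n, taken in [0, n), that are congruent to a nonzero
    integer between -d and d, provided that 2d < n. *)
Definition near0 (n d t : nat) : bool := (0 < t <= d)%N || (n - d <= t)%N.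

(** The bound on d is there because the distance takes the junk value #|T| on
    disconnected pairs. *)
Lemma gdist_leP (T : finType) (e : rel T) (d : nat) (x y : T) :
    (d < #|T|)%N ->
  reflect (exists p, [/\ size p <= d, path e x p & last x p = y]%N)
    (gdist e x y <= d)%N.
Proof.
move=> ltdT; rewrite -ltnS -has_take_leq ?size_iota //.
rewrite take_iota (minn_idPl _) //.
apply: (iffP hasP) => [[k] | [p [le_pd e_p p_y]]].
  rewrite mem_iota ltnS => /= le_kd /existsP[p /andP[e_p /eqP p_y]].
  by exists p; rewrite size_tuple.
exists (size p); first by rewrite mem_iota ltnS.
by apply/existsP; exists (in_tuple p); rewrite /= e_p p_y /=.
Qed.

Lemma circuitE (n : nat) (i j : 'I_n.+2) :
  circuit i j = (j == i + 1) || (i == j + 1).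
Proof. by rewrite /circuit /= -!(@add_Zp_1 n.+2). Qed.

(** Steps in opposite directions cancel out, so a walk ends no farther than its
    length, measured in one direction. *)
Lemma circuit_path_last (n : nat) (i : 'I_n.+2) (p : seq 'I_n.+2) :
    path (@circuit n.+2) i p ->
  exists2 m, (m <= size p)%N & last i p = i + m%:R \/ last i p = i - m%:R.
Proof.
elim: p i => [|j p IHp] i /=; first by exists 0%N; rewrite // addr0; left.
rewrite circuitE => /andP[ij /IHp[m le_mp]] lastE.
have [/eqP Dj | /eqP Di] := orP ij.
  case: lastE => ->; rewrite Dj; last case: m le_mp => [|m] le_mp.
  - by exists m.+1; rewrite // mulrS addrA; left.
  - by exists 1%N; rewrite // mulr0n subr0; left.
  by exists m; [exact: leqW (ltnW _) | right; rewrite mulrS; ring].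
case: lastE => ->; rewrite Di; first case: m le_mp => [|m] le_mp.
- by exists 1%N; rewrite // mulr0n addr0; right; ring.
- by exists m; [exact: leqW (ltnW _) | left; rewrite mulrS addrA].
by exists m.+1; [| right; rewrite mulrS; ring].
Qed.

Lemma circuit_path_forward (n : nat) (i : 'I_n.+2) (m : nat) :
  exists p, [/\ size p = m, path (@circuit n.+2) i p & last i p = i + m%:R].
Proof.
elim: m i => [|m IHm] i; first by exists [::]; rewrite /= addr0.
have [p [sz_p c_p p_last]] := IHm (i + 1).
exists (i + 1 :: p); rewrite /= sz_p circuitE eqxx c_p p_last.
by rewrite mulrS addrA.
Qed.

Lemma circuit_path_backward (n : nat) (i : 'I_n.+2) (m : nat) :
  exists p, [/\ size p = m, path (@circuit n.+2) i p & last i p = i - m%:R].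
Proof.
elim: m i => [|m IHm] i; first by exists [::]; rewrite /= subr0.
have [p [sz_p c_p p_last]] := IHm (i - 1).
exists (i - 1 :: p); rewrite /= sz_p circuitE subrK eqxx orbT c_p p_last.
by rewrite mulrS opprD addrA.
Qed.

(** Walks of length at most d starting at i reach exactly the vertices i + m and
    i - m with m <= d. *)
Lemma dist_power_circuitE (n d : nat) (i j : 'I_n.+2) :
    (0 < d)%N -> (2 * d + 1 < n.+2)%N ->
  dist_power (@circuit n.+2) d i j = near0 n.+2 d (j - i)%R.
Proof.
move=> d_gt0 lt2dn; set k := j - i.
have Dj : j = i + k by rewrite addrC subrK.
have val_nat m : (m < n.+2)%N -> val (m%:R : 'I_n.+2) = m.
  by move=> ltm; rewrite /= (@val_Zp_nat n.+2) // modn_small.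
have val_opp m : (0 < m < n.+2)%N -> val (- m%:R : 'I_n.+2) = (n.+2 - m)%N.
  case/andP=> m0 ltm /=; rewrite (@val_Zp_nat n.+2) // (modn_small ltm).
  by rewrite modn_small //; lia.
have pathE : reflect (exists p,
    [/\ size p <= d, path (@circuit n.+2) i p & last i p = j]%N)
    ((k == 0) || near0 n.+2 d k).
  apply: (iffP idP) => [|[p [le_pd c_p p_j]]].
    case/or3P => [/eqP k0 | /andP[k_gt0 le_kd] | le_ndk].
    - by exists [::]; rewrite Dj k0 addr0.
    - have [p [sz_p c_p p_last]] := circuit_path_forward i k.
      by exists p; rewrite sz_p p_last Dj (@natr_Zp n).
    have [p [sz_p c_p p_last]] := circuit_path_backward i (n.+2 - k).
    exists p; rewrite sz_p p_last Dj; split=> //; first by lia.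
    rewrite natrB ?(@natr_Zp n) 1?ltnW // (@pchar_Zp n.+2) // opprB subr0 //.
  have [m le_mp [p_last|p_last]] := circuit_path_last c_p.
    have Dk : k = m%:R by rewrite /k -p_j p_last addrC addKr.
    case: (posnP m) Dk => [-> | m_gt0] Dk; first by rewrite Dk mulr0n eqxx.
    by rewrite Dk /near0 val_nat; lia.
  have Dk : k = - m%:R by rewrite /k -p_j p_last addrC addKr.
  case: (posnP m) Dk => [-> | m_gt0] Dk; first by rewrite Dk mulr0n oppr0 eqxx.
  by rewrite Dk /near0 val_opp; lia.
have k_neq0 : (k != 0) = (i != j) by rewrite subr_eq0 eq_sym.
have gdistP := @gdist_leP _ (@circuit n.+2) d i j.
rewrite card_ord in gdistP; have {}gdistP := gdistP ltac:(lia).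
apply/orP/idP => [|near_k].
  have near_k : k != 0 -> (exists p,
    [/\ size p <= d, path (@circuit n.+2) i p & last i p = j]%N)
      -> near0 n.+2 d k.
    by move=> nz_k /pathE; rewrite (negPf nz_k).
  case=> [c_ij | /and3P[neq_ij _ /gdistP]].
  2: by apply: near_k; rewrite k_neq0.
  apply: near_k; last by exists [:: j]; rewrite /= c_ij.
  have := c_ij; rewrite circuitE /k => /orP[] /eqP->.
    by rewrite addrC addKr oner_neq0.
  by rewrite opprD addrA subrr sub0r oppr_eq0 oner_neq0.
have nz_k : k != 0 by apply: contraTneq near_k => ->; rewrite /near0 /=; lia.
have /pathE path_p : (k == 0) || near0 n.+2 d k by rewrite near_k orbT.
right; rewrite -k_neq0 nz_k; apply/and3P; split=> //; last exact/gdistP.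
by have [p [_ c_p p_j]] := path_p; apply/connectP; exists p; rewrite ?p_j.
Qed.

(** * Eigenvalue 1 *)

Lemma sum_geometric_nat (R : comNzRingType) (x : R) (a b : nat) : (a <= b)%N ->
  (x - 1) * \sum_(a <= t < b) x ^+ t = x ^+ b - x ^+ a.
Proof.
move=> leab; rewrite big_distrr -telescope_sumr //=.
by apply: eq_bigr => t _; rewrite exprS; ring.
Qed.

Lemma sum_near0 (R : comNzRingType) (n d : nat) (x : R) : (2 * d + 1 < n)%N ->
  \sum_(t < n) (near0 n d t)%:R * x ^+ t
    = \sum_(1 <= t < d.+1) x ^+ t + \sum_(n - d <= t < n) x ^+ t.
Proof.
move=> lt2dn; rewrite -(big_mkord predT (fun t => (near0 n d t)%:R * x ^+ t)).
have onE a b c : {in [pred t | a <= t < b]%N, forall t, near0 n d t = c} ->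
  \sum_(a <= t < b) (near0 n d t)%:R * x ^+ t
    = c%:R * \sum_(a <= t < b) x ^+ t.
  by move=> nearE; rewrite big_distrr; apply: eq_big_nat => t /nearE ->.
rewrite (@big_cat_nat _ _ _ 1 0 n) //=; last by lia.
rewrite (@big_cat_nat _ _ _ d.+1 1 n) //=; last by lia.
rewrite (@big_cat_nat _ _ _ (n - d) d.+1 n) //=; [|lia|lia].
rewrite (onE 0 1 false)%N; last by move=> t; rewrite inE /near0; lia.
rewrite (onE 1 d.+1 true)%N; last by move=> t; rewrite inE /near0; lia.
rewrite (onE d.+1 (n - d) false)%N; last by move=> t; rewrite inE /near0; lia.
rewrite (onE (n - d) n true)%N; last by move=> t; rewrite inE /near0; lia.
by rewrite !mul0r !mul1r !add0r.
Qed.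

Lemma eigenvalue1P (n d : nat) (x : algC) : (2 * d + 1 < n)%N -> x ^+ n = 1 ->
  (\sum_(t < n) (near0 n d t)%:R * x ^+ t == 1)
    = 6.-primitive_root x && (d == 1 %[mod 6])%N.
Proof.
move=> lt2dn xn1; have n_gt0 : (0 < n)%N by lia.
rewrite sum_near0 //; have [-> | x_neq1] := eqVneq x 1.
  rewrite (eq_bigr (fun=> 1)) => [|i _]; last by rewrite expr1n.
  rewrite [X in _ + X](eq_bigr (fun=> 1)) => [|i _]; last by rewrite expr1n.
  (* The eigenvalue is the degree 2d of the graph, an even number. *)
  rewrite !sumr_const_nat -natrD pnatr_eq1.
  transitivity false; first by lia.
  symmetry; apply/negP => /andP[one_6 _].
  by have := prim_order_dvd one_6 1; rewrite expr1 eqxx.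
rewrite -(eigenvalue1_equation d n_gt0 xn1 x_neq1).
have xB1_neq0 : x - 1 != 0 by rewrite subr_eq0.
have x_neq0 : x != 0.
  by apply: contra_eq_neq xn1 => ->; rewrite expr0n gtn_eqF // eq_sym oner_neq0.
have xd_neq0 : x ^+ d != 0 by rewrite expf_neq0.
(* Multiplying by x - 1 collapses the two geometric sums, and multiplying by
   x^d removes the power x^(n-d). *)
rewrite -(inj_eq (mulfI xB1_neq0)) -(inj_eq (mulfI xd_neq0)).
rewrite mulrDr !sum_geometric_nat ?leq_subr // xn1.
have xnd : x ^+ d * x ^+ (n - d) = 1 by rewrite -exprD subnKC // ; lia.
rewrite -subr_eq0 -[in RHS]subr_eq0; congr (_ == 0).
transitivity (x ^+ d * (x ^+ d.+1 - x ^+ 1 + 1) - x ^+ d * x ^+ (n - d)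
  - x ^+ d * ((x - 1) * 1)); first by ring.
by rewrite xnd mul2n -addnn -addnS exprD expr1; ring.
Qed.

(** With n = 6m, the primitive sixth roots of unity are w^m and its inverse
    w^(5m). *)
Lemma card_prim6_powers (n : nat) (w : algC) :
    n.-primitive_root w -> (6 %| n)%N ->
  #|[pred k : 'I_n | 6.-primitive_root (w ^+ k)]| = 2%N.
Proof.
move=> w_n /dvdnP[m Dn]; have n_gt0 := prim_order_gt0 w_n.
have m_gt0 : (0 < m)%N by lia.
have z_6 : 6.-primitive_root (w ^+ m).
  have := exp_prim_root w_n m; rewrite Dn ?(gcdnC _ m) gcdnMr mulKn //.
have ltm : (m < n)%N by lia.
have lt5m : (5 * m < n)%N by lia.
pose k1 := Ordinal ltm; pose k5 := Ordinal lt5m.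
transitivity #|[set k1; k5]|; last first.
  by rewrite cards2 -(inj_eq val_inj) /=; lia.
apply: eq_card => k; rewrite !inE prim6_rootE.
have := z_6; rewrite prim6_rootE => /eqP z_root.
have z_3 := prim6_rootX3 z_6.
transitivity ((w ^+ k - w ^+ m) * (w ^+ k - w ^+ (5 * m)) == 0).
  rewrite mulnC exprM; set x := w ^+ k.
  move: (w ^+ m) z_root z_3 => z z_root z_3.
  congr (_ == 0).
  have -> : z ^+ 5 = 1 - z.
    rewrite (exprD z 3 2) z_3 -[RHS]subr0 -z_root; ring.
  by rewrite -[LHS]subr0 -z_root; ring.
rewrite mulf_eq0 !subr_eq0 !(eq_prim_root_expr w_n).
by rewrite !modn_small ?ltn_ord // -!(inj_eq val_inj).
Qed.

Lemma eigen_mult1_circuit_power (n d : nat) :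
    (0 < d)%N -> (2 * d + 1 < n)%N ->
  eigen_mult (adjmx algC (dist_power (@circuit n) d)) 1
    = (if (6 %| n) && (d == 1 %[mod 6]) then 2 else 0)%N.
Proof.
move=> d_gt0 lt2dn; have n_gt0 : (0 < n)%N by lia.
have [w w_n] := C_prim_root_exists n_gt0.
pose eig k := \sum_(t < n) (near0 n d t)%:R * (w ^+ k) ^+ t.
have char_eig : char_poly (adjmx algC (dist_power (@circuit n) d))
    = \prod_(k < n) ('X - (eig k)%:P).
  case: n => [|[|n]] in lt2dn n_gt0 w_n @eig *; [by []|lia|].
  rewrite -(char_poly_circulant (fun t => (near0 n.+2 d t)%:R) w_n).
  congr char_poly; apply/matrixP => i j.
  by rewrite !mxE dist_power_circuitE.
rewrite /eigen_mult char_eig.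
rewrite -(big_map (fun k : 'I_n => eig k) predT (fun a => 'X - a%:P)).
rewrite mu_prod_XsubC count_map -sum1_count sum1_card.
transitivity
  #|[pred k : 'I_n | 6.-primitive_root (w ^+ k) && (d == 1 %[mod 6])]|.
  apply: eq_card => k; rewrite !inE -[LHS]/(eig k == 1) eigenvalue1P //.
  by rewrite exprAC (prim_expr_order w_n) expr1n.
have [d1 | _] := boolP (d == 1 %[mod 6]); last first.
  by rewrite andbF; apply: eq_card0 => k; rewrite !inE andbF.
rewrite andbT; have [n6 | n6] := boolP (6 %| n)%N.
  rewrite -[RHS](card_prim6_powers w_n n6).
  by apply: eq_card => k; rewrite !inE andbT.
apply: eq_card0 => k; rewrite !inE andbT; apply: contraNF n6 => z_6.
by rewrite (prim_order_dvd z_6) exprAC (prim_expr_order w_n) expr1n.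
Qed.

Theorem theorem8 (R : rcfType) (n d : nat) (hn : (0 < n)%N) (hd : (1 <= d)%N)
    (hdn : (d%:R : rat) < (n%:R - 1) / 2%:R) :
  (eigenvalue (adjmx R (dist_power (@circuit n) d)) 1
     <-> (6 %| n)%N /\ d = 1 %[mod 6])
  /\ ((6 %| n)%N -> d = 1 %[mod 6] ->
      eigen_mult (adjmx R (dist_power (@circuit n) d)) 1 = 2%N).
Proof.
have lt2dn : (2 * d + 1 < n)%N.
  move: hdn; rewrite ltr_pdivlMr ?ltr0n // ltrBrDr -natrM natr1 ltr_nat.
  by rewrite mulnC addn1.
have multR : eigen_mult (adjmx R (dist_power (@circuit n) d)) 1
    = (if (6 %| n) && (d == 1 %[mod 6]) then 2 else 0)%N.
  rewrite -(eigen_mult1_circuit_power hd lt2dn).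
  have mult_rat (L : numFieldType) :
    eigen_mult (adjmx L (dist_power (@circuit n) d)) 1
      = eigen_mult (adjmx rat (dist_power (@circuit n) d)) 1.
    by rewrite -(map_adjmx (@ratr L)) -(rmorph1 (@ratr L)) eigen_mult_map.
  by rewrite (mult_rat R) (mult_rat algC).
rewrite eigenvalue_mult_gt0 multR; split=> [|-> ->]; last by rewrite eqxx.
split=> [|[-> ->]]; last by rewrite eqxx.
by case: ifP => // /andP[-> /eqP].
Qed.
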